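(* Let $F$ be a subset of $\mathbb{R}^d$ satisfying $\inf\{\|x-y\| : x,y\in F,\ x\ne y\}>0$. Fix $k\ge 3$, $\epsilon>0$, and $1\le m\le d$. If the series $$\sum_{v\in F\setminus\{0\}}\|v\|^{-\sigma_0}$$ is divergent for some $$\sigma_0> d+\frac{\log(1-1/k^m)}{\log\big(k\lceil \sqrt d/(2\epsilon)\rceil\big)},$$ then $F$ contains $(k,\epsilon,\mathbf{e})$-APs for every set of orthogonal unit vectors $\mathbf{e}=\{e_1,e_2,\ldots,e_m\}$ in $\mathbb{R}^d$.
   Context: $\|\cdot\|$ is the Euclidean norm on $\mathbb{R}^d$; $\inf\emptyset=\infty$; $k$ and $m$ are integers. Let $\mathbf{e}=\{e_1,\ldots,e_m\}$ be a linearly independent set of vectors in $\mathbb{R}^d$, $1\le m\le d$. For $k\in\mathbb{N}$ and $\Delta>0$, a set $P\subset\mathbb{R}^d$ is an arithmetic patch of size $k$ and scale $\Delta$ with respect to orientation $\mathbf{e}$ if $$P=\Big\{t+\Delta\sum_{i=1}^m x_ie_i : x_i=0,1,\ldots,k-1\Big\}$$ for some $t\in\mathbb{R}^d$. A set $Q\subset\mathbb{R}^d$ is a $(k,\epsilon,\mathbf{e})$-AP if there exists an arithmetic patch $P$ of size $k$ and some scale $\Delta>0$ with respect to orientation $\mathbf{e}$ such that $\#Q=\#P$ and $$\sup_{x\in P}\inf_{y\in Q}\|x-y\|\le\epsilon\Delta.$$ $F$ contains $(k,\epsilon,\mathbf{e})$-APs if some subset $Q\subseteq F$ is a $(k,\epsilon,\mathbf{e})$-AP.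 *)

(* Defs.v *)
From mathcomp Require Import all_boot all_order all_algebra.
From mathcomp Require Import all_classical all_reals all_analysis.

Set Implicit Arguments.
Unset Strict Implicit.
Unset Printing Implicit Defensive.

Import Order.TTheory GRing.Theory Num.Theory.

Local Open Scope classical_set_scope.
Local Open Scope ring_scope.

Definition edot (R : realType) (d : nat) (u v : 'rV[R]_d) : R :=
  \sum_(i < d) u ord0 i * v ord0 i.

(* The library's norm `|v| on 'rV[R]_d is the sup norm. *)
Definition enorm (R : realType) (d : nat) (v : 'rV[R]_d) : R :=
  Num.sqrt (edot v v).

Definition orthonormal_family (R : realType) (d m : nat)
    (e : 'I_m -> 'rV[R]_d) : Prop :=
  (forall i, enorm (e i) = 1) /\ (forall i j, i != j -> edot (e i) (e j) = 0).

(* The infimum is taken in \bar R, so that it is +oo when F has at most one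
   point. *)
Definition uniformly_discrete (R : realType) (d : nat)
    (F : set 'rV[R]_d) : Prop :=
  (0 < ereal_inf [set (enorm (p.1 - p.2))%:E
                 | p in [set p : 'rV[R]_d * 'rV[R]_d |
                          [/\ F p.1, F p.2 & p.1 != p.2]]])%E.

(* The orientation is an indexed family; its linear independence is left to
   the users of this definition. *)
Definition arithmetic_patch (R : realType) (d m k : nat) (Delta : R)
    (e : 'I_m -> 'rV[R]_d) (P : set 'rV[R]_d) : Prop :=
  exists t : 'rV[R]_d,
    P = [set t + Delta *: \sum_(i < m) (x i)%:R *: e i
        | x in [set: {ffun 'I_m -> 'I_k}]].

Definition is_AP (R : realType) (d m k : nat) (eps : R)
    (e : 'I_m -> 'rV[R]_d) (Q : set 'rV[R]_d) : Prop :=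
  exists (P : set 'rV[R]_d) (Delta : R),
    [/\ 0 < Delta, arithmetic_patch k Delta e P, (Q #= P)%card &
        (ereal_sup [set ereal_inf [set (enorm (x - y))%:E | y in Q] | x in P]
         <= (eps * Delta)%:E)%E].

Definition contains_APs (R : realType) (d m k : nat) (eps : R)
    (e : 'I_m -> 'rV[R]_d) (F : set 'rV[R]_d) : Prop :=
  exists Q : set 'rV[R]_d, Q `<=` F /\ is_AP k eps e Q.

(* Main.v *)
Require Import Defs.
From mathcomp Require Import all_boot all_order all_algebra.
From mathcomp Require Import all_classical all_reals all_analysis.
From mathcomp Require Import ring lra.

Import Order.TTheory GRing.Theory Num.Theory.

Local Open Scope classical_set_scope.
Local Open Scope ring_scope.

(** Suppose that [F] contains no [(k, eps, e)]-AP.  Complete [e] to an orthonormal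
basis, the rows of [U], and cut space into half-open cubes parallel to that
basis.  Let [N] be the ceiling of [sqrt d / (2 eps)] and [n = k * N].

Divide a cube of side [n r] into [n ^ d] subcubes of side [r], and fix one of
them.  Moving it by multiples of [N r] along the directions of [e] gives [k ^ m]
subcubes whose centres form an arithmetic patch of size [k] and scale [N r].
Every point of a subcube is within [sqrt d * r / 2 <= eps * (N r)] of its
centre, so if [F] met all [k ^ m] subcubes, a choice of one point in each would
be a [(k, eps, e)]-AP in [F] ([contains_APs_of_full_patch]).  Hence each such
patch of subcubes has a member that misses [F], and at most
[mu = n ^ d * (1 - 1 / k ^ m)] of the [n ^ d] subcubes meet [F] ([card_hit_le]).

Since [F] is uniformly discrete, a cube of some small side [s] holds at most one
point of [F].  Iterating the previous count, a cube of side [s * n ^ j] holds at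
most [mu ^ j] points of [F] ([card_cell_le]).  Now exhaust space by the cubes of
side [s * n ^ j] centred at the origin.  Outside the [j]-th one the norm is at
least [s * n ^ j / 2], so the points of [F] added by the [j+1]-st one contribute
at most a constant times [(mu * n ^ (- sigma)) ^ j] to the series
([shell_sum_le]).  The lower bound on [sigma] says exactly that
[mu < n ^ sigma]; the sum over [j] is then a convergent geometric series, which
contradicts divergence ([esum_finite_of_count]). *)

(** * Euclidean geometry and orthonormal completion *)

Lemma edotE {R : realType} {d : nat} (u v : 'rV[R]_d) :
  edot u v = (u *m v^T) ord0 ord0.
Proof. by rewrite /edot mxE; apply: eq_bigr => i _; rewrite mxE. Qed.

Lemma edot_ge0 {R : realType} {d : nat} (v : 'rV[R]_d) : 0 <= edot v v.
Proof. by apply: sumr_ge0 => i _; rewrite -expr2 sqr_ge0. Qed.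

Lemma enorm_ge0 {R : realType} {d : nat} (v : 'rV[R]_d) : 0 <= enorm v.
Proof. exact: sqrtr_ge0. Qed.

Lemma enorm_sqr {R : realType} {d : nat} (v : 'rV[R]_d) :
  enorm v ^+ 2 = edot v v.
Proof. by rewrite sqr_sqrtr ?edot_ge0. Qed.

Lemma edot_gt0 {R : realType} {d : nat} (v : 'rV[R]_d) :
  v != 0 -> 0 < edot v v.
Proof.
move=> v0; rewrite lt_def edot_ge0 andbT; apply: contra v0.
rewrite psumr_eq0; last by move=> i _; rewrite -expr2 sqr_ge0.
move=> /allP v0; apply/eqP/rowP => i; rewrite mxE; apply/eqP.
by have := v0 i (mem_index_enum i); rewrite /= mulf_eq0 orbb.
Qed.

Lemma enorm_gt0 {R : realType} {d : nat} (v : 'rV[R]_d) :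
  v != 0 -> 0 < enorm v.
Proof. by move=> v0; rewrite sqrtr_gt0 edot_gt0. Qed.

(** With fewer than [d] rows, [A^T] has a nonzero left kernel; normalise one of
its vectors. *)
Lemma exists_orthogonal {R : realType} {d m : nat} (A : 'M[R]_(m, d)) :
  (m < d)%N -> exists2 v : 'rV[R]_d, edot v v = 1 & A *m v^T = 0.
Proof.
move=> md; have : kermx A^T != 0.
  rewrite -mxrank_eq0 mxrank_ker mxrank_tr subn_eq0 -ltnNge.
  exact: leq_ltn_trans (rank_leq_row A) md.
case/rowV0Pn => w /sub_kermxP wA w0.
exists ((enorm w)^-1 *: w).
  rewrite edotE linearZ /= -scalemxAl -scalemxAr !mxE.
  have := edotE w w; rewrite mxE => <-.
  by rewrite -enorm_sqr; field; rewrite gt_eqF ?enorm_gt0.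
by rewrite linearZ /= -scalemxAr -[A]trmxK -trmx_mul wA trmx0 scaler0.
Qed.

(** The rows are added one at a time, by induction on [d - m].  The indices are
compared by value because they have the distinct types ['I_m] and ['I_d]. *)
Lemma orthonormal_completion {R : realType} {d m : nat} (A : 'M[R]_(m, d)) :
  (m <= d)%N -> A *m A^T = 1%:M ->
  exists2 U : 'M[R]_d, U *m U^T = 1%:M &
    forall (i : 'I_m) (j : 'I_d), i = j :> nat -> row j U = row i A.
Proof.
move=> md; move hp : (d - m)%N => p.
elim: p => [|p IH] in m md hp A *.
  have e : m = d by apply/eqP; rewrite eqn_leq md -subn_eq0 hp.
  case: _ / e A {md hp} => A AA; exists A => // i j ij.
  by congr (row _ A); apply: val_inj.
move=> AA; have lt : (m < d)%N by rewrite -subn_gt0 hp.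
have [v v1 vA] := exists_orthogonal A lt.
have [||/=|U UU UA] := IH (m + 1)%N _ _ (col_mx A v).
- by rewrite addn1.
- by rewrite addn1 subnS hp.
- have Av : v *m A^T = 0 by rewrite -[v]trmxK -trmx_mul vA trmx0.
  rewrite tr_col_mx mul_col_row AA vA Av scalar_mx_block; congr block_mx.
  by apply/matrixP => i j; rewrite !ord1 -edotE v1 mxE.
exists U => // i j ij.
by rewrite (UA (lshift 1 i) j ij) rowKu.
Qed.

(** Parseval: [v *m U^T] is the vector of coordinates of [v] in the orthonormal
basis formed by the rows of [U]. *)
Lemma enorm_coord {R : realType} {d : nat} (U : 'M[R]_d) (v : 'rV[R]_d) :
  U *m U^T = 1%:M -> enorm v = enorm (v *m U^T).
Proof.
move=> UU; rewrite /enorm !edotE trmx_mul trmxK.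
by rewrite mulmxA -(mulmxA v) (mulmx1C UU) mulmx1.
Qed.

Lemma enorm_le_coord {R : realType} {d : nat} (v : 'rV[R]_d) (r : R) :
  0 <= r -> (forall i, `|v ord0 i| <= r) -> enorm v <= Num.sqrt d%:R * r.
Proof.
move=> r0 vr; rewrite -[leRHS]ger0_norm ?mulr_ge0// -sqrtr_sqr ler_wsqrtr//.
rewrite exprMn sqr_sqrtr// mulr_natl -[d in _ *+ d]card_ord -sumr_const.
by apply: ler_sum => i _; rewrite -expr2 -real_normK ?num_real// lerXn2r ?nnegrE.
Qed.

Lemma coord_le_enorm {R : realType} {d : nat} (v : 'rV[R]_d) i :
  `|v ord0 i| <= enorm v.
Proof.
rewrite -(sqrtr_sqr (v ord0 i)) ler_wsqrtr// /edot (bigD1 i)//= -expr2 lerDl.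
by apply: sumr_ge0 => j _; rewrite -expr2 sqr_ge0.
Qed.

(** * Cubes and their subdivision *)

(** The cube is half-open so that the subcubes of a subdivision are disjoint; the
corner [t] is given by its coordinates in the basis of the rows of [U]. *)
Definition in_cell {R : realType} {d : nat} (U : 'M[R]_d) (t : 'rV[R]_d)
    (r : R) (v : 'rV[R]_d) : bool :=
  [forall i, t ord0 i <= (v *m U^T) ord0 i < t ord0 i + r].

(** A subcube is indexed in each direction by an integer below [k * N], written as
[N * p + q] with [p < k] and [q < N]: the members of one arithmetic patch differ
in the leading digits [p] only. *)
Definition corner {R : realType} {d k N : nat}
    (a : {ffun 'I_d -> 'I_k * 'I_N}) : 'rV[R]_d :=
  \row_i (N * (a i).1 + (a i).2)%:R.

Lemma digits_inj {k N : nat} (p q : 'I_k * 'I_N) :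
  (N * p.1 + p.2 = N * q.1 + q.2)%N -> p = q.
Proof.
case: p q => [p1 p2] [q1 q2] /= e; have N0 := leq_ltn_trans (leq0n _) (ltn_ord p2).
congr pair; apply: val_inj => /=.
  have /= := congr1 (fun x => x %/ N)%N e.
  by rewrite !(mulnC N) !divnMDl// !divn_small// !addn0.
have /= := congr1 (fun x => x %% N)%N e.
by rewrite !(mulnC N) !modnMDl !modn_small.
Qed.

Lemma digits_exist {k N : nat} (q : nat) :
  (q < k * N)%N -> exists p : 'I_k * 'I_N, q = (N * p.1 + p.2)%N.
Proof.
move=> qkN; have N0 : (0 < N)%N by move: qkN; case: N => //; rewrite muln0.
have qk : (q %/ N < k)%N by rewrite ltn_divLR.
by exists (Ordinal qk, Ordinal (ltn_pmod q N0)); rewrite /= mulnC -divn_eq.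
Qed.

Lemma subcell_exists {R : realType} {d k N : nat} (U : 'M[R]_d) (t : 'rV[R]_d) (r : R)
    (v : 'rV[R]_d) :
  0 < r -> in_cell U t (r * (k * N)%:R) v ->
  exists a : {ffun 'I_d -> 'I_k * 'I_N}, in_cell U (t + r *: corner a) r v.
Proof.
move=> r0 /forallP/= tv.
have dig i : exists p : 'I_k * 'I_N,
    (N * p.1 + p.2)%:R <= ((v *m U^T) ord0 i - t ord0 i) / r
    < (N * p.1 + p.2)%:R + 1.
  set z := _ / r; have /andP[tv1 tv2] := tv i.
  have z0 : 0 <= z by rewrite divr_ge0 ?subr_ge0 ?(ltW r0).
  have zkN : z < (k * N)%:R by rewrite ltr_pdivrMr// mulrC ltrBlDl.
  have [|p pE] := @digits_exist k N (Num.trunc z); first by rewrite truncn_lt_nat.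
  by exists p; rewrite -pE natr1; exact: truncn_itv.
have [a aP] := choice dig; exists [ffun i => a i]; apply/forallP => i /=.
have /andP[] := aP i; rewrite !mxE ffunE ler_pdivlMr// ltr_pdivrMr//.
lra.
Qed.

Lemma subcell_uniq {R : realType} {d k N : nat} (U : 'M[R]_d) (t : 'rV[R]_d) (r : R)
    (v : 'rV[R]_d)
    (a b : {ffun 'I_d -> 'I_k * 'I_N}) :
  0 < r -> in_cell U (t + r *: corner a) r v ->
  in_cell U (t + r *: corner b) r v -> a = b.
Proof.
move=> r0 /forallP/= av /forallP/= bv; apply/ffunP => i.
apply: digits_inj; have /andP[] := av i; have /andP[] := bv i; rewrite !mxE.
set x := (X in t ord0 i + r * X%:R <= _ -> _).
set y := (X in _ -> _ -> t ord0 i + r * X%:R <= _ -> _); set z := \sum_j _.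
have lt (p q : nat) : t ord0 i + r * p%:R <= z -> z < t ord0 i + r * q%:R + r ->
    (p <= q)%N.
  move=> h1 h2; rewrite -ltnS -(ltr_nat R) -natr1 -(ltr_pM2l r0).
  rewrite mulrDr mulr1; lra.
by move=> h1 h2 h3 h4; apply/eqP; rewrite eqn_leq !lt.
Qed.

(** * Patches of subcubes and arithmetic progressions *)

(** As [x] varies, the centres of these subcubes form an arithmetic patch whose
scale is [N] times the side: [insub] recognises the first [m] directions, those
of [e]. *)
Definition patch_cell {d m k N : nat} (a : {ffun 'I_d -> 'I_k * 'I_N})
    (x : {ffun 'I_m -> 'I_k}) : {ffun 'I_d -> 'I_k * 'I_N} :=
  [ffun i : 'I_d => (if insub (i : nat) is Some j then x j else (a i).1, (a i).2)].

Lemma patch_cell_inj {d m k N : nat} (a : {ffun 'I_d -> 'I_k * 'I_N}) :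
  (m <= d)%N -> injective (@patch_cell d m k N a).
Proof.
move=> md x y /ffunP xy; apply/ffunP => i.
have := xy (widen_ord md i); rewrite !ffunE.
by case: insubP => [j _ /val_inj-> []|]//=; rewrite ltn_ord.
Qed.

(** Only the leading digits in the directions of [e] depend on [x]; everything else
is collected in the base point [c]. *)
Lemma patch_cell_center {R : realType} {d m k N : nat} (U : 'M[R]_d)
    (e : 'I_m -> 'rV[R]_d) (t : 'rV[R]_d) (r : R)
    (a : {ffun 'I_d -> 'I_k * 'I_N}) :
  (m <= d)%N -> (forall (i : 'I_m) (j : 'I_d), i = j :> nat -> row j U = e i) ->
  exists c : 'rV[R]_d, forall x : {ffun 'I_m -> 'I_k},
    c + (r * N%:R) *: \sum_(i < m) (x i)%:R *: e i =
    (t + r *: corner (patch_cell a x) + const_mx (r / 2)) *m U.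
Proof.
move=> md Ue.
(* coordinates of the [x]-dependent part of the patch *)
pose w (x : {ffun 'I_m -> 'I_k}) : 'rV[R]_d :=
  \row_j (if insub (j : nat) is Some i then (x i)%:R else 0).
have wE (x : {ffun 'I_m -> 'I_k}) : \sum_(i < m) (x i)%:R *: e i = w x *m U.
  rewrite mulmx_sum_row (bigID (fun j : 'I_d => (j < m)%N))/= [X in _ + X]big1.
    rewrite addr0 (big_ord_narrow md); apply: eq_bigr => i _.
    rewrite (Ue i)// mxE; congr (_ *: _).
    by case: insubP => [j _ /val_inj->|]//=; rewrite ltn_ord.
  by move=> j jm; rewrite mxE insubF ?scale0r//; apply/negbTE.
exists ((\row_j (t ord0 j + r / 2 + r * (N * (if (insub (j : nat) : option 'I_m) is
   Some _ then 0 else (a j).1) + (a j).2)%:R)) *m U) => x.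
rewrite wE scalemxAl -mulmxDl; congr (_ *m U); apply/rowP => j; rewrite !mxE ffunE.
case: insubP => [i _ _|_] /=; rewrite ?muln0 ?mulr0 !natrD !natrM; lra.
Qed.

(** One point of [F] is picked in each subcube of the patch.  The picked points are
distinct because the subcubes are disjoint, and each is within half a diagonal,
[sqrt d * r / 2], of the centre of its subcube. *)
Lemma contains_APs_of_full_patch {R : realType} {d m k N : nat}
    (F : set 'rV[R]_d) (eps : R) (U : 'M[R]_d)
    (e : 'I_m -> 'rV[R]_d) (t : 'rV[R]_d) (r : R)
    (a : {ffun 'I_d -> 'I_k * 'I_N}) :
  (m <= d)%N -> U *m U^T = 1%:M ->
  (forall (i : 'I_m) (j : 'I_d), i = j :> nat -> row j U = e i) ->
  (0 < N)%N -> Num.sqrt d%:R / 2 <= eps * N%:R -> 0 < r ->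
  (forall x : {ffun 'I_m -> 'I_k}, exists2 v, F v &
     in_cell U (t + r *: corner (patch_cell a x)) r v) ->
  contains_APs k eps e F.
Proof.
move=> md UU Ue N0 Neps r0 full.
have [y yP] := choice (fun x => let: ex_intro2 v Fv vc := full x in
  ex_intro (fun v => F v /\ in_cell U (t + r *: corner (patch_cell a x)) r v)
    v (conj Fv vc)).
have [c cP] := patch_cell_center U e t r a md Ue.
pose p (x : {ffun 'I_m -> 'I_k}) := c + (r * N%:R) *: \sum_(i < m) (x i)%:R *: e i.
have pcoord x : p x *m U^T = t + r *: corner (patch_cell a x) + const_mx (r / 2).
  by rewrite /p cP -mulmxA UU mulmx1.
(* Centres lie in their own subcubes, so that disjointness of the subcubes
   makes both the centres and the picked points pairwise distinct. *)
have pcell x : in_cell U (t + r *: corner (patch_cell a x)) r (p x).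
  by apply/forallP => i; rewrite pcoord; set q := t + _; rewrite !mxE; lra.
have inj (f : _ -> 'rV[R]_d) :
    (forall x, in_cell U (t + r *: corner (patch_cell a x)) r (f x)) ->
    {in [set: {ffun 'I_m -> 'I_k}] &, injective f}.
  move=> fP x x' _ _ ff; apply: (patch_cell_inj a md).
  by apply: (subcell_uniq U t r (f x)) => //; rewrite ff.
exists [set y x | x in setT]; split; first by move=> _ [x _ <-]; case: (yP x).
exists [set p x | x in setT], (r * N%:R); split.
- by rewrite mulr_gt0 ?ltr0n.
- by exists c.
- apply: card_eq_trans (inj_card_eq (inj y (fun x => (yP x).2))) _.
  by apply: card_esym; exact: inj_card_eq (inj p pcell).
- apply/ereal_supP => _ [_ [x _ <-] <-].
  apply: (@le_trans _ _ (enorm (p x - y x))%:E).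
    by apply: ereal_inf_lbound; exists (y x) => //; exists x.
  rewrite lee_fin (enorm_coord U)//; apply: (@le_trans _ _ (Num.sqrt d%:R * (r / 2))).
    apply: enorm_le_coord => [|i]; first by rewrite divr_ge0 ?ltW.
    have [_ /forallP/(_ i)] := yP x; rewrite mulmxBl pcoord; set q := t + _.
    rewrite [X in `|X|]mxE [X in `|X + _|]mxE [const_mx _ _ _]mxE [X in `|_ + X|]mxE.
    by rewrite ler_norml; lra.
  by have := ler_wpM2r (ltW r0) Neps; lra.
Qed.

(** * Counting points in cubes *)

(** Any [a] is recovered from a subcube of its patch that lies outside [S] together
with the leading digits of [a] in the first [m] directions.  Hence the
complement of [S] times [k ^ m] covers all [(k * N) ^ d] indices. *)
Lemma card_hit_le {R : realType} {d m k N : nat}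
    (S : {set {ffun 'I_d -> 'I_k * 'I_N}}) :
  (m <= d)%N -> (0 < k)%N ->
  (forall a, exists x : {ffun 'I_m -> 'I_k}, patch_cell a x \notin S) ->
  #|S|%:R <= (k * N)%:R ^+ d * (1 - 1 / k%:R ^+ m) :> R.
Proof.
move=> md k0 Sx; pose T := {ffun 'I_d -> 'I_k * 'I_N}.
have cT : #|[set: T]%SET| = ((k * N) ^ d)%N.
  by rewrite cardsT card_ffun card_prod !card_ord.
have : ((k * N) ^ d <= #|(~: S)%SET| * k ^ m)%N.
  have -> : (k ^ m = #|[set: {ffun 'I_m -> 'I_k}]%SET|)%N.
    by rewrite cardsT card_ffun !card_ord.
  rewrite -cT -cardsX; apply: leq_trans (leq_imset_card
    (fun p : T * {ffun 'I_m -> 'I_k} => patch_cell p.1 p.2) _).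
  apply/subset_leq_card/fintype.subsetP => a _; have [x xS] := Sx a.
  (* The second component restores the digits that [x] has replaced. *)
  apply/imsetP; exists (patch_cell a x, [ffun i => (a (widen_ord md i)).1]).
    by rewrite finset.in_setX finset.in_setT andbT finset.in_setC.
  apply/ffunP => i; rewrite !ffunE /=.
  case: insubP => [j _ ji|_]; last by case: (a i).
  rewrite ffunE (_ : widen_ord md j = i); last exact: val_inj.
  by case: (a i).
have := cardsC S; rewrite -cardsT cT => e; rewrite -(leq_add2l (#|S| * k ^ m)).
rewrite -mulnDl e -(ler_nat R) natrD !natrM !natrX !natrM.
have K0 : 0 < k%:R ^+ m :> R by rewrite exprn_gt0 ?ltr0n.
move: K0; set K := k%:R ^+ m; set n := (_ * _) ^+ d => K0 h.
rewrite -(ler_pM2l K0) (_ : K * (n * _) = n * K - n); first by lra.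
by field; rewrite gt_eqF.
Qed.

(** Induction on the scale: a cube of side [s * (k * N) ^ (j + 1)] has at most [mu]
subcubes of side [s * (k * N) ^ j] that meet [F].  Finite sets of points are
duplicate-free sequences here, which avoids proving beforehand that [F] is
finite in each cube. *)
Lemma card_cell_le {R : realType} {d k N : nat} (F : set 'rV[R]_d)
    (U : 'M[R]_d) (s mu : R) :
  0 < s -> (0 < k * N)%N ->
  (forall t v w, F v -> F w -> in_cell U t s v -> in_cell U t s w -> v = w) ->
  (forall t r (S : {set {ffun 'I_d -> 'I_k * 'I_N}}), 0 < r ->
    (forall a, a \in S -> exists2 v, F v & in_cell U (t + r *: corner a) r v) ->
    #|S|%:R <= mu) ->
  forall (j : nat) (t : 'rV[R]_d) (X : seq 'rV[R]_d), uniq X ->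
    {in X, forall v, F v /\ in_cell U t (s * (k * N)%:R ^+ j) v} ->
    (size X)%:R <= mu ^+ j.
Proof.
move=> s0 kN0 Fs Fmu; elim=> [|j IH] t X uX XF.
  case: X uX XF => [|v [|w X]]//= /andP[vX _] XF.
  have [Fv cv] := XF v (mem_head _ _).
  have [|Fw cw] := XF w; first by rewrite !inE eqxx orbT.
  move: vX; rewrite (Fs t v w) ?mem_head//; last by move: cw; rewrite mulr1.
  by move: cv; rewrite mulr1.
pose r := s * (k * N)%:R ^+ j.
have r0 : 0 < r by rewrite mulr_gt0 ?exprn_gt0 ?ltr0n.
pose hit (a : {ffun 'I_d -> 'I_k * 'I_N}) v := in_cell U (t + r *: corner a) r v.
pose S := [set a | has (hit a) X]%SET.
have mu0 : 0 <= mu.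
  by apply: le_trans (Fmu t r finset.set0 r0 _) => // a; rewrite finset.in_set0.
have Smu : #|S|%:R <= mu.
  apply: (Fmu t r) => // a; rewrite finset.in_set => /hasP[v vX av].
  by exists v => //; case: (XF v vX).
have le : (size X <= \sum_(a in S) count (hit a) X)%N.
  have -> : (\sum_(a in S) count (hit a) X = \sum_(v <- X) \sum_(a in S) hit a v)%N.
    rewrite exchange_big; apply: eq_bigr => a _; rewrite -sum1_count big_mkcond.
    by apply: eq_bigr => v _; case: (hit a v).
  rewrite -sum1_size big_seq [leqRHS]big_seq; apply: leq_sum => v vX.
  have [_ cv] := XF v vX.
  have [|a av] := @subcell_exists R d k N U t r v r0.
    by rewrite /r -mulrA -exprSr.
  rewrite (bigD1 a) ?[hit a v]av//= finset.in_set; apply/hasP; by exists v.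
rewrite -(ler_nat R) in le; apply: (le_trans le).
apply: (@le_trans _ _ (\sum_(a in S) mu ^+ j)).
  rewrite natr_sum; apply: ler_sum => a _; rewrite -size_filter.
  apply: (IH (t + r *: corner a)); first exact: filter_uniq.
  by move=> v; rewrite mem_filter => /andP[av /XF[]].
by rewrite sumr_const -mulr_natl exprS ler_wpM2r ?exprn_ge0.
Qed.

(** * Summing over shells *)

(** The points of [C j.+1] outside [C j] number at most [mu ^ j.+1] and contribute
at most [B * q ^ j] each, so the shells are dominated by the geometric series
with first term [B * mu] and ratio [mu * q].  The induction splits a
sequence in [C j.+1] by membership in [C j]. *)
Lemma shell_sum_le {R : realType} {T : eqType} (P : set T)
    (C : nat -> pred T) (f : T -> R) (K B mu q : R) :
  0 <= K -> 0 <= B -> 0 <= mu -> 0 <= q -> mu * q < 1 ->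
  (forall j X, uniq X -> {in X, forall v, P v /\ C j v} ->
    (size X)%:R <= mu ^+ j) ->
  (forall v, P v -> C 0 v -> f v <= K) ->
  (forall j v, P v -> ~~ C j v -> f v <= B * q ^+ j) ->
  forall J X, uniq X -> {in X, forall v, P v /\ C J v} ->
    \sum_(v <- X) f v <= K + B * mu / (1 - mu * q).
Proof.
move=> K0 B0 mu0 q0 muq1 card fK fB J X uX XC.
have sum_le (c : R) (Y : seq T) : {in Y, forall v, f v <= c} ->
    \sum_(v <- Y) f v <= (size Y)%:R * c.
  move=> Yc; rewrite big_seq mulr_natl -sum1_size -sumrMnr [leRHS]big_seq.
  exact: ler_sum.
have muq0 : 0 <= mu * q by rewrite mulr_ge0.
apply: (@le_trans _ _ (K + B * mu * ((1 - (mu * q) ^+ J) / (1 - mu * q)))).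
  elim: J X uX XC => [|J IH] X uX XC.
    apply: le_trans (sum_le K X _) _; first by move=> v /XC[Pv /(fK v Pv)].
    rewrite expr0 subrr mul0r mulr0 addr0 ler_piMl//.
    exact: card 0 X uX XC.
  rewrite (bigID (C J))/= -[X in X + _ <= _]big_filter -[X in _ + X <= _]big_filter.
  have -> : K + B * mu * ((1 - (mu * q) ^+ J.+1) / (1 - mu * q)) =
      K + B * mu * ((1 - (mu * q) ^+ J) / (1 - mu * q)) +
      mu ^+ J.+1 * (B * q ^+ J).
    by rewrite !exprS !exprMn; field; lra.
  apply: lerD.
    apply: IH; first exact: filter_uniq.
    by move=> v; rewrite mem_filter => /andP[? /XC[]].
  apply: le_trans (sum_le (B * q ^+ J) _ _) _.
    by move=> v; rewrite mem_filter => /andP[? /XC[Pv _]]; exact: fB.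
  rewrite ler_wpM2r ?mulr_ge0 ?exprn_ge0//; apply: (card J.+1).
    exact: filter_uniq.
  by move=> v; rewrite mem_filter => /andP[_ /XC].
rewrite lerD2l ler_wpM2l ?mulr_ge0// ler_piMl ?invr_ge0 ?subr_ge0 ?(ltW muq1)//.
by rewrite lerBlDr lerDl exprn_ge0.
Qed.


Lemma uniformly_discrete_gap {R : realType} {d : nat} (F : set 'rV[R]_d) :
  uniformly_discrete F -> exists2 delta : R, 0 < delta &
    forall v w, F v -> F w -> v != w -> delta <= enorm (v - w).
Proof.
rewrite /uniformly_discrete; set S := [set _ | _ in _] => S0.
have lb v w : F v -> F w -> v != w -> (ereal_inf S <= (enorm (v - w))%:E)%E.
  by move=> Fv Fw vw; apply: ereal_inf_lbound; exists (v, w).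
case: (ereal_inf S) S0 lb => [delta| |//] /= d0 lb.
  by exists delta => // v w Fv Fw vw; rewrite -lee_fin lb.
by exists 1 => // v w Fv Fw vw; have := lb v w Fv Fw vw.
Qed.

(** The diagonal of a cube of side [delta / (sqrt d + 1)] is shorter than the least
distance [delta] between points of [F]. *)
Lemma small_cell_inj {R : realType} {d : nat} (F : set 'rV[R]_d) (U : 'M[R]_d) :
  U *m U^T = 1%:M -> uniformly_discrete F ->
  exists2 s : R, 0 < s & forall t v w, F v -> F w ->
    in_cell U t s v -> in_cell U t s w -> v = w.
Proof.
move=> UU /uniformly_discrete_gap[delta d0 gap].
have q0 := sqrtr_ge0 (d%:R : R); set q := Num.sqrt _ in q0.
exists (delta / (q + 1)); first by rewrite divr_gt0 ?ltr_wpDl.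
move=> t v w Fv Fw /forallP tv /forallP tw; apply/eqP/negPn/negP => vw.
suff : enorm (v - w) <= q * (delta / (q + 1)).
  apply/negP; rewrite -ltNge; apply: lt_le_trans (gap v w Fv Fw vw).
  by rewrite mulrA ltr_pdivrMr ?ltr_wpDl// mulrC ltr_pM2l// ltrDl.
rewrite (enorm_coord U)//; apply: enorm_le_coord => [|i].
  by rewrite divr_ge0 ?ltW ?ltr_wpDl.
have /andP[v1 v2] := tv i; have /andP[w1 w2] := tw i.
rewrite mulmxBl mxE [X in `|_ + X|]mxE ler_norml; lra.
Qed.

Lemma seq_in_centered_cell {R : realType} {d n : nat} (U : 'M[R]_d) (s : R)
    (X : seq 'rV[R]_d) : U *m U^T = 1%:M -> 0 < s -> (1 < n)%N ->
  exists J, {in X, forall v,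
    in_cell U (const_mx (- (s * n%:R ^+ J / 2))) (s * n%:R ^+ J) v}.
Proof.
move=> UU s0 n1; pose b := \sum_(v <- X) enorm v.
have [J bJ] : exists J, 2 * b < s * n%:R ^+ J.
  exists (Num.trunc (2 * b / s)).+1; rewrite [ltRHS]mulrC -ltr_pdivrMr//.
  apply: (lt_le_trans (truncnS_gt _)); rewrite -natrX ler_nat.
  exact/ltnW/ltn_expl.
exists J => v vX; move: (s * n%:R ^+ J) bJ => r br.
have vb : enorm v <= b.
  by rewrite /b (big_rem v)//= lerDl; apply: sumr_ge0 => w _; exact: enorm_ge0.
apply/forallP => i; rewrite mxE; move: (coord_le_enorm (v *m U^T) i).
rewrite -enorm_coord// ler_norml; move: (_ ord0 i) (enorm v) vb => x y.
by move: (b) br => c; lra.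
Qed.

Lemma enorm_ge_off_centered_cell {R : realType} {d : nat} (U : 'M[R]_d) (r : R)
    (v : 'rV[R]_d) : U *m U^T = 1%:M ->
  ~~ in_cell U (const_mx (- (r / 2))) r v -> r / 2 <= enorm v.
Proof.
move=> UU; rewrite negb_forall => /existsP[i]; rewrite mxE negb_and -!ltNge.
have := coord_le_enorm (v *m U^T) i; rewrite -enorm_coord// ler_norml.
by move=> /andP[h1 h2] /orP[] h; lra.
Qed.

(** Off the origin-centred cube of side [s * n ^ j] the summand is at most
[(s / 2) ^ (- sigma) * (n ^ (- sigma)) ^ j], so the shells form a geometric
series with ratio [mu * n ^ (- sigma) < 1]. *)
Lemma esum_finite_of_count {R : realType} {d n : nat} (F : set 'rV[R]_d)
    (U : 'M[R]_d) (s mu sigma : R) :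
  U *m U^T = 1%:M -> 0 < s -> (1 < n)%N -> 0 <= mu -> 0 <= sigma ->
  mu < n%:R `^ sigma ->
  (forall (j : nat) (t : 'rV[R]_d) (X : seq 'rV[R]_d), uniq X ->
    {in X, forall v, F v /\ in_cell U t (s * n%:R ^+ j) v} ->
    (size X)%:R <= mu ^+ j) ->
  (\esum_(v in F `\ 0%R) (enorm v `^ (- sigma))%:E < +oo)%E.
Proof.
move=> UU s0 n1 mu0 sigma0 mun count.
pose C (j : nat) := in_cell U (const_mx (- (s * n%:R ^+ j / 2))) (s * n%:R ^+ j).
have n0 : 0 < n%:R :> R by rewrite ltr0n ltnW.
(* The innermost cube holds at most one point of [F], which provides [K]. *)
have [K K0 KP] : exists2 K : R, 0 <= K &
    forall v, (F `\ 0) v -> C 0%N v -> enorm v `^ (- sigma) <= K.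
  have [[w [Fw cw]]|no] := pselect (exists w, F w /\ C 0%N w); last first.
    by exists 0 => // v [Fv _] cv; case: no; exists v.
  exists (enorm w `^ (- sigma)) => [|v [Fv _] cv]; first exact: powR_ge0.
  have [->//|vw] := eqVneq v w.
  suff : 2 <= mu ^+ 0 by rewrite expr0 (ler_nat R 2 1).
  apply: (count 0%N (const_mx (- (s * n%:R ^+ 0 / 2))) [:: v; w]).
    by rewrite /= inE vw.
  by move=> u; rewrite !inE => /orP[] /eqP->.
have q0 : 0 <= n%:R `^ (- sigma) := powR_ge0 _ _.
have fB j v : (F `\ 0) v -> ~~ C j v ->
    enorm v `^ (- sigma) <= (s / 2) `^ (- sigma) * (n%:R `^ (- sigma)) ^+ j.
  move=> _ /(enorm_ge_off_centered_cell U _ _ UU) vj.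
  rewrite -powR_mulrn// powRAC powR_mulrn ?(ltW n0)//.
  rewrite -powRM ?exprn_ge0 ?divr_ge0 ?(ltW s0) ?(ltW n0)//.
  rewrite !powRN lef_pV2 ?posrE ?powR_gt0//.
  - apply: ge0_ler_powR; rewrite ?nnegrE ?enorm_ge0//.
      by rewrite mulr_ge0 ?exprn_ge0 ?divr_ge0 ?(ltW s0) ?(ltW n0).
    by rewrite mulrAC.
  - by apply: lt_le_trans vj; rewrite divr_gt0 ?mulr_gt0 ?exprn_gt0.
  - by rewrite mulr_gt0 ?exprn_gt0 ?divr_gt0.
have muq1 : mu * n%:R `^ (- sigma) < 1.
  by rewrite powRN ltr_pdivrMr ?mul1r// powR_gt0.
apply: le_lt_trans (ltry (K + (s / 2) `^ (- sigma) * mu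
  / (1 - mu * n%:R `^ (- sigma)))).
apply/ereal_supP => _ [A [finA AF] <-].
rewrite fsbig_finite// sumEFin lee_fin.
have [J JP] := seq_in_centered_cell U s (finmap.enum_fset (fset_set A)) UU s0 n1.
apply: (shell_sum_le (F `\ 0) C _ _ _ _ _ K0 _ mu0 q0 muq1 _ KP fB J) => //.
- exact: powR_ge0.
- move=> j X uX XC; apply: (count j _ X uX) => v /XC[[Fv _] cv].
  by split; [exact: Fv|exact: cv].
- exact: finmap.fset_uniq.
- move=> v vA; split; last exact: JP.
  by apply: AF; move: vA; rewrite in_fset_set// inE.
Qed.

(** * Divergence forces arithmetic progressions *)

Theorem corollary1p6 (R : realType) (d : nat) (F : set 'rV[R]_d)
    (hF : uniformly_discrete F)
    (k m : nat) (eps : R)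
    (hk : (3 <= k)%N) (heps : 0 < eps) (hm : (1 <= m <= d)%N)
    (hdiv : exists sigma0 : R,
       d%:R + ln (1 - 1 / k%:R ^+ m)
              / ln (k%:R * (Num.ceil (Num.sqrt d%:R / (2 * eps)))%:~R)
         < sigma0 /\
       \esum_(v in F `\ 0) (enorm v `^ (- sigma0))%:E = +oo%E) :
  forall e : 'I_m -> 'rV[R]_d, orthonormal_family e -> contains_APs k eps e F.
Proof.
move=> e [e1 e0]; have [sigma [hsigma hinf]] := hdiv.
have /andP[m0 md] := hm; have d0 := leq_trans m0 md.
have k0 : (0 < k)%N by exact: leq_trans hk.
have c0 : 0 < Num.sqrt d%:R / (2 * eps) by rewrite divr_gt0 ?sqrtr_gt0 ?ltr0n ?mulr_gt0.
have [N N0 NE] : exists2 N : nat, (0 < N)%N &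
    Num.ceil (Num.sqrt d%:R / (2 * eps)) = N.
  have := ceil_ge (Num.sqrt d%:R / (2 * eps)) => /(lt_le_trans c0).
  by rewrite ltr0z; case: Num.ceil => // N N0; exists N.
have Neps : Num.sqrt d%:R / 2 <= eps * N%:R.
  have := ceil_ge (Num.sqrt d%:R / (2 * eps)); rewrite NE.
  by rewrite ler_pdivrMr ?mulr_gt0// -pmulrn; lra.
pose E : 'M[R]_(m, d) := \matrix_(i, j) e i ord0 j.
have rowE i : row i E = e i by apply/rowP => j; rewrite !mxE.
have [U UU UE] : exists2 U : 'M[R]_d, U *m U^T = 1%:M &
    forall (i : 'I_m) (j : 'I_d), i = j :> nat -> row j U = row i E.
  apply: orthonormal_completion => //; apply/matrixP => i j; rewrite !mxE.
  have -> : \sum_l E i l * E^T l j = edot (e i) (e j).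
    by apply: eq_bigr => l _; rewrite !mxE.
  by have [->|/e0->//] := eqVneq i j; rewrite -enorm_sqr e1 expr1n.
apply: contrapT => noAP.
pose mu : R := (k * N)%:R ^+ d * (1 - 1 / k%:R ^+ m).
have hit t r (S : {set {ffun 'I_d -> 'I_k * 'I_N}}) : 0 < r ->
    (forall a, a \in S -> exists2 v, F v & in_cell U (t + r *: corner a) r v) ->
    #|S|%:R <= mu.
  move=> r0 SF; apply: (@card_hit_le R d m k N) => // a; apply: contrapT => full.
  apply: noAP; apply: (contains_APs_of_full_patch F eps U e t r a) => // [i j ij|x].
    by rewrite (UE i j).
  by apply: SF; apply: contrapT => /negP xS; apply: full; exists x.
have [s s0 sF] := small_cell_inj F U UU hF.
have kN0 : (0 < k * N)%N by rewrite muln_gt0 k0.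
have kN1 : (2 < k * N)%N by exact: leq_trans hk (leq_pmulr _ N0).
have kN3 : 3 <= (k * N)%:R :> R by rewrite (ler_nat R 3).
have km3 : 3 <= k%:R ^+ m :> R.
  by rewrite -natrX (ler_nat R 3) (leq_trans hk)// -[leqLHS]expn1 leq_exp2l// ltnW.
have kmV : 1 / k%:R ^+ m <= 1 / 3 :> R.
  by rewrite !div1r lef_pV2 ?posrE//; exact: lt_le_trans km3.
(* [1 <= mu] is what makes [sigma] nonnegative, so that the summand decreases
   with the norm. *)
have mu1 : 1 <= mu.
  have h : 3 <= (k * N)%:R ^+ d :> R.
    by rewrite -natrX (ler_nat R 3) (leq_trans kN1)// -[leqLHS]expn1 leq_exp2l// ltnW.
  rewrite /mu; nra.
have ln0 : 0 < ln (k * N)%:R :> R by rewrite ln_gt0//; lra.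
(* The hypothesis on [sigma], multiplied by [ln (k * N)]. *)
have lnmu : ln mu < sigma * ln (k * N)%:R.
  move: hsigma; rewrite NE -pmulrn -natrM -(ltr_pM2r ln0).
  rewrite mulrDl divfK ?gt_eqF// => /(le_lt_trans _); apply.
  rewrite lnM ?posrE; [|by rewrite exprn_gt0 ?ltr0n|lra].
  by rewrite lerD2r lnXn ?ltr0n// mulr_natl.
have mun : mu < (k * N)%:R `^ sigma.
  by rewrite -ltr_ln ?posrE ?powR_gt0 ?ltr0n ?ln_powR//; lra.
have sigma0 : 0 <= sigma.
  by rewrite -(pmulr_lge0 _ ln0) (le_trans (ln_ge0 mu1))// ltW.
have := card_cell_le F U s mu s0 kN0 sF hit.
move=> /(esum_finite_of_count F U s mu sigma UU s0 (ltnW kN1) _ sigma0 mun).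
by rewrite hinf ltxx => /(_ (le_trans ler01 mu1)).
Qed.
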